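(* Let $\varepsilon$ be a real number with $0<\varepsilon\le 1$, let $k$ be a positive integer with $k\ge 6$, and let $$a=\frac{5-1.5\,\varepsilon}{2-\sqrt{4-\varepsilon}}-6.$$ Then $$R(4,3;k,1)\le \frac{(k-6)(k+6+2a)}{4-\varepsilon}+16<\frac{(k+a)^2}{4-\varepsilon}$$ and $$R(4,3;k,1)-R(4,3;k-1,1)<1+\frac{k+a}{\sqrt{4-\varepsilon}}.$$
   Context: All graphs are finite and simple. For positive integers $n,r,k,s$ with $n,k\ge 2$, the generalized Ramsey number $R(n,r;k,s)$ is the smallest positive integer $p$ such that for every graph $G$ of order $p$ (i.e. with $p$ vertices), either $G$ contains a subgraph induced by $n$ vertices with at most $r-1$ edges, or the complement $\overline G$ of $G$ contains a subgraph induced by $k$ vertices with at most $s-1$ edges. *)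

(* Defs.v *)
From mathcomp Require Import all_boot all_order all_algebra.
From mathcomp Require Import boolp reals.

Set Implicit Arguments.
Unset Strict Implicit.
Unset Printing Implicit Defensive.

Record sgraph := SGraph {
  vertex :> finType;
  adj : rel vertex;
  adj_sym : symmetric adj;
  adj_irrefl : irreflexive adj }.

Section Graph.
Variable G : sgraph.

Definition cadj : rel G := [rel x y | (x != y) && ~~ adj x y].

Lemma cadj_sym : symmetric cadj.
Proof. by move=> x y; rewrite /cadj /= eq_sym adj_sym. Qed.

Lemma cadj_irrefl : irreflexive cadj.
Proof. by move=> x; rewrite /cadj /= eqxx. Qed.

Definition compl : sgraph := SGraph cadj_sym cadj_irrefl.

(* Each edge is counted once, as the unordered pair of its endpoints. *)
Definition induced_edges (A : {set G}) : {set {set G}} :=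
  [set [set x; y] | x in A, y in A & adj x y].

Definition has_sparse (n m : nat) : Prop :=
  exists A : {set G}, #|A| = n /\ #|induced_edges A| <= m.

End Graph.

Definition ramsey_prop (n r k s p : nat) : Prop :=
  0 < p /\
  forall G : sgraph, #|G| = p ->
    has_sparse G n (r - 1) \/ has_sparse (compl G) k (s - 1).

Lemma ramsey_sub (n k : nat) : exists p : nat,
  forall (G : sgraph) (A : {set G}), p <= #|A| ->
  exists B : {set G}, B \subset A /\
    ((#|B| = n /\ {in B &, forall x y, ~~ adj x y}) \/
     (#|B| = k /\ {in B &, forall x y, x != y -> adj x y})).
Proof.
have [N] := ubnP (n + k); elim: N n k => // N IH [|n] [|k] lt_nk;
  try by exists 0 => G A _; exists set0; rewrite sub0set cards0; split => //;
    first [by left; split => // x y; rewrite inE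
          |by right; split => // x y; rewrite inE].
have [|p Hp] := IH n k.+1; first by rewrite -ltnS -addSn.
have [|q Hq] := IH n.+1 k; first by rewrite -ltnS -addnS.
exists (p + q).+1 => G A leA.
have /card_gt0P[v vA] : 0 < #|A| by apply: leq_trans leA.
pose C := [set x in A | adj v x]; pose D := [set x in A :\ v | ~~ adj v x].
have cardA : #|A| = (#|C| + #|D|).+1.
  rewrite (cardsD1 v A) vA add1n -(cardsID [set x | adj v x] (A :\ v)).
  congr (_ + _).+1; apply: eq_card => x; rewrite /C /D !inE.
    by have [->|_] := eqVneq x v; rewrite ?adj_irrefl ?andbF.
  by rewrite [RHS]andbC.
have [leD|ltD] := leqP p #|D|.
  have [B [sB HB]] := Hp G D leD.
  have sDA : D \subset A by apply/subsetP => x; rewrite !inE => /andP[/andP[]].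
  case: HB => [[cB iB]|HB]; last first.
    by exists B; split; [exact: subset_trans sDA|right].
  exists (v |: B); split.
    by rewrite subUset sub1set vA (subset_trans sB).
  left; split.
    rewrite cardsU1 cB; case vB: (v \in B) => //.
    by have := subsetP sB _ vB; rewrite !inE eqxx.
  move=> x y; rewrite !inE => /orP[/eqP->|xB] /orP[/eqP->|yB].
  - by rewrite adj_irrefl.
  - by have := subsetP sB _ yB; rewrite !inE => /andP[].
  - by have := subsetP sB _ xB; rewrite !inE adj_sym => /andP[].
  - exact: iB.
have leC : q <= #|C|.
  by rewrite -(leq_add2l p); move: leA; rewrite cardA ltnS => /leq_trans; apply;
     rewrite addnC leq_add2r ltnW.
have [B [sB HB]] := Hq G C leC.
have sCA : C \subset A by apply/subsetP => x; rewrite !inE => /andP[].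
case: HB => [HB|[cB iB]].
  by exists B; split; [exact: subset_trans sCA|left].
exists (v |: B); split.
  by rewrite subUset sub1set vA (subset_trans sB).
right; split.
  rewrite cardsU1 cB; case vB: (v \in B) => //.
  by have := subsetP sB _ vB; rewrite !inE adj_irrefl andbF.
move=> x y; rewrite !inE => /orP[/eqP->|xB] /orP[/eqP->|yB].
- by rewrite eqxx.
- by have := subsetP sB _ yB; rewrite !inE => /andP[].
- by have := subsetP sB _ xB; rewrite !inE adj_sym => /andP[].
- exact: iB.
Qed.

Lemma ramsey_ex (n r k s : nat) : exists p, `[< ramsey_prop n r k s p >].
Proof.
have [p Hp] := ramsey_sub n k.
exists p.+1; apply/asboolP; split=> // G cG.
have [|B [_ HB]] := Hp G [set: G]; first by rewrite cardsT cG.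
have edge0 (H : sgraph) (A : {set H}) m :
    {in A &, forall x y, ~~ adj x y} -> #|induced_edges A| <= m.
  move=> iA; rewrite (_ : induced_edges A = set0) ?cards0 //.
  apply/setP => E; rewrite in_set0; apply/negP => /imset2P[x y xA].
  by rewrite inE => /andP[yA]; rewrite (negPf (iA x y xA yA)).
case: HB => [[cB iB]|[cB iB]]; [left|right]; exists B; split=> //;
  apply: edge0 => // x y xB yB /=.
by rewrite negb_and !negbK; have [//|ne] := eqVneq x y; exact: iB.
Qed.

(* The generalized Ramsey number R(n,r;k,s), for positive r and s (the
   truncated differences r - 1 and s - 1 only matter when r or s is 0). *)
Definition ramsey (n r k s : nat) : nat := ex_minn (ramsey_ex n r k s).

(* Main.v *)
Require Import Defs.
From mathcomp Require Import all_boot all_order all_algebra.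
From mathcomp Require Import boolp reals.
From mathcomp Require Import zify ring lra.
Import Order.TTheory GRing.Theory Num.Theory.
Local Open Scope ring_scope.

(** Write f(k) for R(4,3;k,1), and pass to the complement H of G: four vertices
    with at most two edges in G are four vertices with at least four edges in
    H, and such a quadruple contains a 4-cycle or a paw (a triangle with a
    pendant edge).  So f(k) is the least p such that every graph on p vertices
    with neither a 4-cycle nor a paw has k independent vertices.

    The growth of f comes from one vertex deletion.  Let H be extremal for
    f(k), so that it has n = f(k) - 1 vertices, and let v have minimum degree
    d.  Deleting v and its neighbours leaves fewer than f(k-1) vertices,
    otherwise k-1 independent ones among them would extend by v; hence
    f(k) <= f(k-1) + 1 + d.  If d >= 3, a triangle would extend to a paw, so H
    has no triangle and no 4-cycle, and the Moore bound gives d^2 + 1 <= n.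
    Altogether d <= 2 or d^2 + 2 <= f(k) (ramsey_recurrence).

    For the induction to start at k = 6 one needs f(6) <= 16.  The extremal
    example for small k is a disjoint union of triangles, and
    f(k+1) <= 3k + 1 holds for k <= 5 (stable_small): a vertex of degree at
    most 2 is deleted at the cost of three vertices, and when there is none
    the graph is triangle-free, where 3, 6, 8, 12 vertices already force
    2, 3, 4, 5 independent ones.

    Finally put b = a + 6 and x = k + a.  The claimed bound is
    g(x) = (x^2 - b^2)/(4 - eps) + 16, and its increment is
    g(x) - g(x-1) = (2x - 1)/(4 - eps).  The constant a is so large that
    this increment is at least 1 + sqrt(g(x) - 2) (gap_ge_sqrt), while the
    recurrence bounds the increment of f by 1 + sqrt(f(k) - 2); so f cannot
    overtake g (bound_step).  The strict inequality is 16(4 - eps) < b^2, and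
    the bound on f(k) - f(k-1) is 1 + d < 1 + sqrt(f(k)) fed with the first
    bound. *)

(** * Independent sets in graphs with neither 4-cycle nor paw *)

Section RelativeDegrees.
Local Open Scope nat_scope.
Variable H : sgraph.
Implicit Types (A B : {set H}) (v w x y : H) (k d : nat).

(** Degrees and non-neighbourhoods are taken inside a vertex set, so that
    vertices can be deleted without changing the ambient graph. *)
Definition nb A v : {set H} := [set x in A | adj v x].

Definition far A v : {set H} := [set x in A | (x != v) && ~~ adj v x].

Definition stable B : Prop := {in B &, forall x y, ~~ adj x y}.

Definition has_stable A k : Prop :=
  exists B, [/\ B \subset A, #|B| = k & stable B].

Definition paw_free : Prop := forall x y z w,
  adj x y -> adj y z -> adj z x -> adj x w -> w != y -> w != z -> False.

Definition C4_free : Prop := forall x y z w,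
  adj x y -> adj y z -> adj z w -> adj w x -> x != z -> y != w -> False.

Definition triangle_free A : Prop := forall x y z,
  x \in A -> y \in A -> z \in A -> adj x y -> adj y z -> adj z x -> False.

Lemma far_sub A v : far A v \subset A.
Proof. by apply/subsetP => x; rewrite inE => /andP[]. Qed.

Lemma triangle_free_sub A B :
  B \subset A -> triangle_free A -> triangle_free B.
Proof. by move=> /subsetP s t x y z /s xA /s yA /s zA; apply: t. Qed.

Lemma card_nb_far A v : v \in A -> #|A| = (#|nb A v| + #|far A v|).+1.
Proof.
move=> vA; rewrite (cardsD1 v A) vA add1n.
rewrite -(cardsID [set x | adj v x] (A :\ v)).
congr (_ + _).+1; apply: eq_card => x; rewrite !inE.
  by have [->|_] := eqVneq x v; rewrite ?adj_irrefl ?andbF.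
by case: (x \in A); case: (x == v); case: (adj v x).
Qed.

Lemma subset_of_card B d : d <= #|B| ->
  exists2 C : {set H}, C \subset B & #|C| = d.
Proof.
move=> led; exists [set x in take d (enum B)].
  by apply/subsetP => x; rewrite inE => /mem_take; rewrite mem_enum.
by rewrite cardsE (card_uniqP _) ?take_uniq ?enum_uniq // size_takel -?cardE.
Qed.

Lemma has_stable_shrink A k d : d <= k -> has_stable A k -> has_stable A d.
Proof.
move=> le_dk [B [sB cB iB]].
have [|C sC cC] := subset_of_card B d; first by rewrite cB.
exists C; split=> //; first exact: subset_trans sB.
by move=> x y /(subsetP sC) xB /(subsetP sC) yB; apply: iB.
Qed.

Lemma has_stable_far A v k :
  v \in A -> has_stable (far A v) k -> has_stable A k.+1.
Proof.
move=> vA [B [/subsetP sB cB iB]]; exists (v |: B); split.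
- apply/subsetP => x; rewrite !inE => /orP[/eqP->//|/sB].
  by rewrite inE => /andP[].
- rewrite cardsU1 cB; case vB: (v \in B) => //.
  by have := sB _ vB; rewrite inE eqxx andbF.
move=> x y; rewrite !inE => /orP[/eqP->|xB] /orP[/eqP->|yB].
- by rewrite adj_irrefl.
- by have := sB _ yB; rewrite inE => /and3P[].
- by have := sB _ xB; rewrite inE adj_sym => /and3P[].
- exact: iB.
Qed.

Lemma has_stable_nb A v k :
  triangle_free A -> v \in A -> k <= #|nb A v| -> has_stable A k.
Proof.
move=> tA vA lek; apply: has_stable_shrink lek _; exists (nb A v); split=> //.
  by apply/subsetP => x; rewrite inE => /andP[].
move=> x y; rewrite !inE => /andP[xA vx] /andP[yA vy]; apply/negP => xy.
by apply: (tA v x y) => //; rewrite adj_sym.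
Qed.

Lemma min_degree A : 0 < #|A| ->
  exists2 v, v \in A & {in A, forall x, #|nb A v| <= #|nb A x|}.
Proof.
case/card_gt0P => u uA.
by case: (arg_minnP (fun x => #|nb A x|) uA) => v vA vmin; exists v.
Qed.

(** A vertex of a triangle has a third neighbour, which completes a paw. *)
Lemma triangle_free_min_degree A : paw_free ->
  {in A, forall x, 2 < #|nb A x|} -> triangle_free A.
Proof.
move=> pf dA x y z xA yA zA xy yz zx.
have : 0 < #|nb A x :\: [set y; z]|.
  rewrite cardsD subn_gt0 (leq_ltn_trans _ (dA x xA)) //.
  by rewrite (leq_trans (subset_leq_card (subsetIr _ _))) // cards2; case: (_ != _).
case/card_gt0P => w; rewrite !inE negb_or => /andP[/andP[wy wz] /andP[_ xw]].
exact: (pf x y z w).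
Qed.

Lemma triangle_free_stable2 A : triangle_free A -> 2 < #|A| -> has_stable A 2.
Proof.
move=> tA A3; have /card_gt0P[v vA] : 0 < #|A| by exact: leq_trans A3.
have [lt2|] := leqP 2 #|nb A v|; first exact: has_stable_nb lt2.
move=> dv; have /card_gt0P[w wF] : 0 < #|far A v|.
  by move: A3; rewrite (card_nb_far A v vA); lia.
apply: (has_stable_far A v) => //; exists [set w].
split; rewrite ?cards1 ?sub1set //.
by move=> x y; rewrite !inE => /eqP-> /eqP->; rewrite adj_irrefl.
Qed.

Lemma triangle_free_stable3 A : triangle_free A -> 5 < #|A| -> has_stable A 3.
Proof.
move=> tA A6; have /card_gt0P[v vA] : 0 < #|A| by exact: leq_trans A6.
have [le3|dv] := leqP 3 #|nb A v|; first exact: has_stable_nb le3.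
apply: (has_stable_far A v) => //; apply: triangle_free_stable2.
  exact: triangle_free_sub (far_sub A v) tA.
by move: A6; rewrite (card_nb_far A v vA); lia.
Qed.

(** The common neighbour [u] is counted once, so [a], [b] and their
    neighbours are at most five vertices.  Three remain, and two of these are
    not adjacent; they extend [a] and [b]. *)
Lemma stable4_of_degree2_pair A u a b : triangle_free A -> 7 < #|A| ->
  u \in A -> a \in nb A u -> b \in nb A u -> a != b ->
  #|nb A a| <= 2 -> #|nb A b| <= 2 -> has_stable A 4.
Proof.
move=> tA A8 uA; rewrite !inE => /andP[aA ua] /andP[bA ub] ab da db.
have bF : b \in far A a.
  rewrite inE bA eq_sym ab; apply/negP => adjab.
  by apply: (tA u a b) => //; rewrite adj_sym.
apply: (has_stable_far A a) => //; apply: (has_stable_far _ b) => //.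
apply: triangle_free_stable2.
  apply: triangle_free_sub tA; exact: subset_trans (far_sub _ _) (far_sub _ _).
have db' : #|nb (far A a) b| < #|nb A b|.
  apply: proper_card; apply/properP; split.
    by apply/subsetP => x; rewrite !inE => /andP[/andP[-> _] ->].
  by exists u; rewrite !inE ?uA ?(adj_sym b) ?(adj_sym a) ?ub ?ua ?andbF.
by move: A8; rewrite (card_nb_far A a aA) (card_nb_far _ b bF); lia.
Qed.

Section NoFourCycle.
Hypothesis c4 : C4_free.

(** Count the vertices at distance 2 from [v].  A neighbour [x] of [v] sees,
    besides [v], only vertices of [far A v], there being no triangle; and a
    vertex of [far A v] is seen by at most one such [x], there being no
    4-cycle. *)
Lemma degree_sum_nb A v : triangle_free A -> v \in A ->
  \sum_(x in nb A v) #|nb A x| < #|A|.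
Proof.
move=> tA vA; rewrite (card_nb_far A v vA) ltnS.
have -> : \sum_(x in nb A v) #|nb A x|
    = \sum_(x in nb A v) (1 + #|nb (far A v) x|).
  apply: eq_bigr => x; rewrite inE => /andP[xA vx].
  rewrite (cardsD1 v) inE vA adj_sym vx; congr (_ + _).
  apply: eq_card => w; rewrite !inE.
  case wA: (w \in A); case xw: (adj x w); rewrite ?andbF ?andbT //=.
  case: eqVneq => //= _; apply/esym/negP => vw.
  by apply: (tA v x w) => //; rewrite adj_sym.
rewrite big_split /= sum1_card leq_add2l.
have -> : \sum_(x in nb A v) #|nb (far A v) x|
    = \sum_(w in far A v) #|nb (nb A v) w|.
  rewrite (eq_bigr (fun x => \sum_(w in far A v | adj x w) 1)) => [|x _];
    last first.
    by rewrite -sum1_card; apply: eq_bigl => w; rewrite !inE.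
  rewrite (exchange_big_dep (fun w => w \in far A v)) /=;
    last by move=> x w _ /andP[].
  apply: eq_bigr => w wF; rewrite -sum1_card; apply: eq_bigl => x.
  by rewrite wF [in RHS]inE adj_sym.
rewrite -sum1_card; apply: leq_sum => w; rewrite !inE => /and3P[wA wv nvw].
apply/card_le1P => x; rewrite !inE => /andP[/andP[xA vx] wx] y; rewrite !inE.
apply/andP/eqP => [[/andP[yA vy] wy]|->]; last by rewrite xA vx.
apply/eqP/negPn/negP => yx.
by apply: (c4 v x w y) => //; rewrite 1?adj_sym // eq_sym.
Qed.

Lemma moore_bound A v d : triangle_free A -> v \in A -> d <= #|nb A v| ->
  {in A, forall x, d <= #|nb A x|} -> d * d < #|A|.
Proof.
move=> tA vA dv dA; apply: leq_ltn_trans (degree_sum_nb A v tA vA).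
apply: (@leq_trans (\sum_(x in nb A v) d)).
  by rewrite sum_nat_const leq_mul2r dv orbT.
by apply: leq_sum => x; rewrite inE => /andP[xA _]; apply: dA.
Qed.

(** Deletions and the Moore bound reduce the problem to eight vertices with
    degrees 2 and 3.  The degrees of the neighbours of a vertex [u] of degree 3
    sum to at most 7 by [degree_sum_nb], so two neighbours of [u] have degree
    2; if all degrees are 2 any [u] has this property. *)
Lemma triangle_free_stable4 A : triangle_free A -> 7 < #|A| -> has_stable A 4.
Proof.
move=> tA A8; have [v vA vmin] := min_degree A (leq_trans (isT : 0 < 8) A8).
have far6 w : w \in A -> 6 <= #|far A w| -> has_stable A 4.
  move=> wA F6; apply: (has_stable_far A w) => //.
  apply: triangle_free_stable3 => //.
  exact: triangle_free_sub (far_sub A w) tA.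
have cv := card_nb_far A v vA.
have [big|dv6] := leqP 6 #|far A v|; first exact: far6 big.
have dA : {in A, forall x, 2 <= #|nb A x|}.
  by move=> x /vmin; apply: leq_trans; lia.
have dv : #|nb A v| = 2.
  have := moore_bound A v _ tA vA (leqnn _) vmin; have := dA v vA.
  have [le4|] := leqP 4 #|nb A v|; last first.
    by move: #|nb A v| cv => [|[|[|[|//]]]]; lia.
  nia.
have A8' : #|A| = 8 by lia.
have [/existsP[u /andP[uA du]]|none] :=
    boolP [exists u, (u \in A) && (2 < #|nb A u|)].
  have [le4|lt4] := leqP 4 #|nb A u|; first exact: has_stable_nb le4.
  pose C := [set x in nb A u | #|nb A x| <= 2].
  have : 1 < #|C|.
    have := degree_sum_nb A u tA uA; rewrite A8' (bigID (mem C)) /=.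
    have cC : #|C| + #|nb A u :\: C| = #|nb A u|.
      rewrite -(cardsID C (nb A u)) (setIidPr _) //.
      by apply/subsetP => x; rewrite inE => /andP[].
    have : 2 * #|C| <= \sum_(x in nb A u | x \in C) #|nb A x|.
      rewrite mulnC -sum_nat_const [leqRHS](eq_bigl (mem C)).
        apply: leq_sum => x; rewrite !inE => /andP[/andP[xA _] _]; exact: dA.
      by move=> x; rewrite !inE andbA andbb.
    have : 3 * #|nb A u :\: C| <= \sum_(x in nb A u | x \notin C) #|nb A x|.
      rewrite mulnC -sum_nat_const.
      rewrite [leqLHS](eq_bigl (fun x => (x \in nb A u) && (x \notin C))).
        by apply: leq_sum => x /andP[xN]; rewrite inE xN -ltnNge.
      by move=> x; rewrite in_setD andbC.
    lia.
  case/card_gt1P => a [b []]; rewrite !inE => /andP[aN da] /andP[bN db] ab.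
  by apply: (stable4_of_degree2_pair A u a b); rewrite // inE.
have le2 x : x \in A -> #|nb A x| <= 2.
  move=> xA; rewrite leqNgt; apply: contraNN none => h.
  by apply/existsP; exists x; rewrite xA.
have /card_gt1P[a [b [aN bN ab]]] : 1 < #|nb A v| by rewrite dv.
apply: (stable4_of_degree2_pair A v a b) => //; apply: le2.
  by move: aN; rewrite inE => /andP[].
by move: bN; rewrite inE => /andP[].
Qed.

(** A vertex of minimum degree 4 leaves enough vertices because the Moore
    bound then forces at least 17 of them. *)
Lemma triangle_free_stable5 A : triangle_free A -> 11 < #|A| -> has_stable A 5.
Proof.
move=> tA A12; have [v vA vmin] := min_degree A (leq_trans (isT : 0 < 12) A12).
have [le5|lt5] := leqP 5 #|nb A v|; first exact: has_stable_nb le5.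
apply: (has_stable_far A v) => //; apply: triangle_free_stable4.
  exact: triangle_free_sub (far_sub A v) tA.
have := moore_bound A v _ tA vA (leqnn _) vmin.
have := card_nb_far A v vA; nia.
Qed.

(** The threshold [3 * k] is the order of [k] disjoint triangles, which is why a
    vertex of degree at most 2 can be deleted without loss.  Once the minimum
    degree is 3, triangles are excluded and the sharper triangle-free bounds
    apply to the rest; the case [k = 5] also uses the Moore bound. *)
Lemma stable_small A k : paw_free -> k <= 5 -> 3 * k < #|A| ->
  has_stable A k.+1.
Proof.
move=> pf; elim: k A => [|k IH] A k5 Ak.
  have /card_gt0P[v vA] : 0 < #|A| by exact: leq_trans Ak.
  apply: (has_stable_far A v) => //; exists set0.
  by split; rewrite ?sub0set ?cards0 // => x y; rewrite inE.
have [v vA vmin] := min_degree A (leq_trans (isT : 0 < _.+1) Ak).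
have cv := card_nb_far A v vA.
have [d3|d2] := ltnP 2 #|nb A v|; last first.
  by apply: (has_stable_far A v) => //; apply: IH; lia.
have tA : triangle_free A.
  by apply: triangle_free_min_degree => // x /vmin; apply: leq_trans.
have [lek|ltk] := leqP k.+2 #|nb A v|; first exact: has_stable_nb lek.
have mo := moore_bound A v _ tA vA (leqnn _) vmin.
have tF : triangle_free (far A v) := triangle_free_sub _ _ (far_sub A v) tA.
apply: (has_stable_far A v) => //.
move: k k5 Ak ltk {IH} => [|[|[|[|[|//]]]]] _ Ak ltk.
- lia.
- lia.
- by apply: triangle_free_stable3 => //; lia.
- by apply: triangle_free_stable4 => //; lia.
- by apply: triangle_free_stable5 => //; nia.
Qed.

End NoFourCycle.
End RelativeDegrees.

(** * The Ramsey numbers R(4,3;k,1) *)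

Section RamseyNumbers.
Local Open Scope nat_scope.

Lemma has_sparse0P (K : sgraph) k : has_sparse K k 0 <-> has_stable K setT k.
Proof.
split=> [[B [cB]]|[B [_ cB iB]]].
  rewrite leqn0 cards_eq0 => /eqP iB; exists B; split; rewrite ?subsetT //.
  move=> x y xB yB; apply/negP => xy.
  have : [set x; y] \in induced_edges B.
    by apply/imset2P; exists x y; rewrite ?inE ?yB.
  by rewrite iB inE.
exists B; split=> //; rewrite leqn0 cards_eq0; apply/eqP/setP => E.
rewrite in_set0; apply/negP => /imset2P[x y xB].
by rewrite inE => /andP[yB]; rewrite (negPf (iB x y xB yB)).
Qed.

(** A 4-cycle or a paw in the complement accounts for four of the six pairs of
    its vertices; [P] and [Q] are the two remaining pairs. *)
Lemma has_sparse_two_edges (G : sgraph) (x y z w : G) (P Q : {set G}) :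
  uniq [:: x; y; z; w] ->
  {in [:: x; y; z; w] &,
    forall u v, adj u v -> [set u; v] = P \/ [set u; v] = Q} ->
  has_sparse G 4 2.
Proof.
move=> un PQ; exists [set u in [:: x; y; z; w]]; split.
  by rewrite cardsE (card_uniqP un).
apply: (@leq_trans #|[set P; Q]|); last by rewrite cards2; case: (_ != _).
apply/subset_leq_card/subsetP => E /imset2P[u v uA].
rewrite inE => /andP[vA uv] ->; move: uA vA; rewrite !in_set => uA vA.
by have [->|->] := PQ u v uA vA uv; rewrite !inE eqxx ?orbT.
Qed.

Lemma compl_C4_free (G : sgraph) : ~ has_sparse G 4 2 -> C4_free (compl G).
Proof.
move=> nsp x y z w /andP[xy /negPf nxy] /andP[yz /negPf nyz] /andP[zw /negPf nzw]
  /andP[wx /negPf nwx] xz yw.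
apply: nsp; apply: (@has_sparse_two_edges G x y z w [set x; z] [set y; w]).
  by rewrite /= !inE !negb_or xy xz yz yw zw eq_sym wx.
move=> u v; rewrite !inE => /or4P[]/eqP-> /or4P[]/eqP->;
  rewrite ?adj_irrefl ?nxy ?nyz ?nzw ?nwx // 1?adj_sym
    ?nxy ?nyz ?nzw ?nwx // => _; auto; rewrite setUC; auto.
Qed.

Lemma compl_paw_free (G : sgraph) : ~ has_sparse G 4 2 -> paw_free (compl G).
Proof.
move=> nsp x y z w /andP[xy /negPf nxy] /andP[yz /negPf nyz] /andP[zx /negPf nzx]
  /andP[xw /negPf nxw] wy wz.
apply: nsp; apply: (@has_sparse_two_edges G x y z w [set y; w] [set z; w]).
  by rewrite /= !inE !negb_or xy (eq_sym x z) zx xw yz (eq_sym y) wy (eq_sym z) wz.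
move=> u v; rewrite !inE => /or4P[]/eqP-> /or4P[]/eqP->;
  rewrite ?adj_irrefl ?nxy ?nyz ?nzx ?nxw // 1?adj_sym
    ?nxy ?nyz ?nzx ?nxw // => _; auto; rewrite setUC; auto.
Qed.

Lemma ramsey_le n r k s p : ramsey_prop n r k s p -> ramsey n r k s <= p.
Proof.
by move=> Hp; rewrite /ramsey; case: ex_minnP => q _; apply; apply/asboolP.
Qed.

Lemma ramsey_spec n r k s : ramsey_prop n r k s (ramsey n r k s).
Proof. by rewrite /ramsey; case: ex_minnP => q /asboolP. Qed.

Section Induced.
Variables (G : sgraph) (B : {set G}).

Definition induced_adj : rel {x | x \in B} := [rel x y | adj (val x) (val y)].

Lemma induced_adj_sym : symmetric induced_adj.
Proof. by move=> x y; apply: adj_sym. Qed.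

Lemma induced_adj_irrefl : irreflexive induced_adj.
Proof. by move=> x; apply: adj_irrefl. Qed.

Definition induced : sgraph := SGraph induced_adj_sym induced_adj_irrefl.

Lemma card_induced : #|induced| = #|B|.
Proof. by rewrite card_sig; apply: eq_card. Qed.

Lemma has_sparse_induced n m : has_sparse induced n m -> has_sparse G n m.
Proof.
case=> A [cA eA]; exists (val @: A); split.
  by rewrite card_imset //; apply: val_inj.
apply: leq_trans eA.
apply: (@leq_trans
    #|[set (val @: E : {set G}) | E : {set induced} in induced_edges A]|);
  last exact: leq_imset_card.
apply/subset_leq_card/subsetP => E /imset2P[u v /imsetP[x xA ->]].
rewrite inE => /andP[/imsetP[y yA ->] xy] ->; apply/imsetP.
exists [set x; y]; last by rewrite imsetU !imset_set1.
by apply/imset2P; exists x y; rewrite ?inE ?yA.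
Qed.

Lemma has_stable_compl_induced k :
  has_stable (compl induced) setT k -> has_stable (compl G) B k.
Proof.
case=> A [_ cA iA]; exists (val @: A); split.
- by apply/subsetP => _ /imsetP[x _ ->]; apply: (valP x).
- by rewrite card_imset //; apply: val_inj.
move=> _ _ /imsetP[x xA ->] /imsetP[y yA ->].
exact: (iA x y xA yA).
Qed.

End Induced.

(** The defining property concerns graphs of order exactly
    [ramsey 4 3 k 1]; it passes to large vertex sets of any graph by taking the
    subgraph induced on a subset of that size. *)
Lemma ramsey_has_stable (G : sgraph) k (A : {set G}) :
  ~ has_sparse G 4 2 -> ramsey 4 3 k 1 <= #|A| -> has_stable (compl G) A k.
Proof.
move=> nsp leA; have [_ spec] := ramsey_spec 4 3 k 1.
have [B sB cB] := subset_of_card G A _ leA.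
have [sp|/has_sparse0P/has_stable_compl_induced[C [sC cC iC]]] :=
    spec (induced G B) (etrans (card_induced G B) cB).
  by case: nsp; apply: has_sparse_induced sp.
by exists C; split=> //; apply: subset_trans sB.
Qed.

Lemma ramsey_6_le16 : ramsey 4 3 6 1 <= 16.
Proof.
apply: ramsey_le; split=> // G cG.
have [|nsp] := pselect (has_sparse G 4 2); [by left|right].
apply/has_sparse0P; apply: stable_small => //.
- exact: compl_C4_free.
- exact: compl_paw_free.
by rewrite cardsT cG.
Qed.

(** The witness [d] is the minimum degree of the complement of an extremal
    graph, which has [ramsey 4 3 k.+1 1 - 1] vertices. *)
Lemma ramsey_recurrence k : exists d,
  ramsey 4 3 k.+1 1 <= ramsey 4 3 k 1 + d.+1 /\
  (d <= 2 \/ d * d + 2 <= ramsey 4 3 k.+1 1).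
Proof.
set p := ramsey 4 3 k 1; set q := ramsey 4 3 k.+1 1.
(* For [q = 1] there is no graph of order [q - 1] to look at. *)
have [q1|q2] := leqP q 1; first by exists 0; split; [lia|left].
have [G [cG nsp nst]] : exists G : sgraph,
    [/\ #|G| = q.-1, ~ has_sparse G 4 2 & ~ has_sparse (compl G) k.+1 0].
  apply: contrapT => none; have : q <= q.-1; last by lia.
  apply: ramsey_le; split=> [|G cG]; first by lia.
  by apply: contrapT => /not_orP[nsp nst]; apply: none; exists G.
pose H := compl G; have c4 : C4_free H := compl_C4_free _ nsp.
have cH : #|[set: H]| = q.-1 by rewrite cardsT.
have [|v vA vmin] := min_degree H setT; first by rewrite cH; lia.
have cv := card_nb_far H setT v vA.
exists #|nb H setT v|; split.
  rewrite leqNgt; apply/negP => big; apply: nst; apply/has_sparse0P.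
  apply: (has_stable_far H setT v) => //; apply: ramsey_has_stable => //.
  by have : p <= #|far H setT v|; [lia | exact: id].
have [|d3] := leqP #|nb H setT v| 2; [by left|right].
have tH : triangle_free H setT.
  apply: triangle_free_min_degree; first exact: compl_paw_free.
  by move=> x /vmin; apply: leq_trans.
by have := moore_bound H c4 setT v _ tH vA (leqnn _) vmin; lia.
Qed.

End RamseyNumbers.

(** * Real estimates *)

Section RealEstimates.
Variable R : realFieldType.
Implicit Types eps s b x : R.

Lemma sqrt_gt eps s : eps <= 1 -> 0 <= s -> s ^+ 2 = 4 - eps -> 17 / 10 < s.
Proof. by move=> e1 s0 sE; rewrite ltNge; apply/negP => le; nra. Qed.

Lemma sqrt_lt2 eps s : 0 < eps -> 0 <= s -> s ^+ 2 = 4 - eps -> s < 2.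
Proof. by move=> e0 s0 sE; rewrite ltNge; apply/negP => le; nra. Qed.

(** Multiplying by 2 + s turns the denominator 2 - s into eps, so that [b] has
    order 1/eps. *)
Lemma eps_b_gt12 eps s b : 0 < eps -> eps <= 1 -> 0 <= s ->
  s ^+ 2 = 4 - eps -> b * (2 - s) = 5 - 3 / 2 * eps -> 12 < eps * b.
Proof.
move=> e0 e1 s0 sE bE; have := sqrt_gt _ _ e1 s0 sE.
suff -> : eps * b = (5 - 3 / 2 * eps) * (2 + s) by nra.
have -> : eps * b = b * (2 - s) * (2 + s).
  by rewrite (_ : eps = 4 - s ^+ 2); [ring | lra].
by rewrite bE.
Qed.

(** After clearing denominators this is a quadratic inequality in [x] with
    leading coefficient eps.  Its part depending on [x] is at least -100/eps,
    which the term (4 - eps) * b^2, at least 432/eps^2, outweighs. *)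
Lemma gap_ge_sqrt eps b x : 0 < eps -> eps <= 1 -> 12 < eps * b -> b + 1 <= x ->
  (x ^+ 2 - b ^+ 2) / (4 - eps) + 16 - 2 <= ((2 * x - 1) / (4 - eps) - 1) ^+ 2.
Proof.
move=> e0 e1 eb xb; rewrite -subr_ge0.
have c0 : 4 - eps != 0 by apply/eqP; lra.
rewrite (_ : _ - _ = (eps * x ^+ 2 - 4 * (5 - eps) * x + (5 - eps) ^+ 2
   + (4 - eps) * b ^+ 2 - 14 * (4 - eps) ^+ 2) / (4 - eps) ^+ 2); last by field.
apply: divr_ge0; last by apply: sqr_ge0.
(* Multiplying by eps allows completing the square in [eps * x]. *)
rewrite -(pmulr_rge0 _ e0).
have h1 : 0 <= (eps * x - 2 * (5 - eps)) ^+ 2 by apply: sqr_ge0.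
have h2 : 144 <= (eps * b) ^+ 2 by nra.
have h3 : 432 <= (4 - eps) * (eps * b) ^+ 2 by nra.
have h4 : (4 - eps) ^+ 2 <= 16 by nra.
have h5 : (5 - eps) ^+ 2 <= 25 by nra.
have h6 : eps * (4 - eps) ^+ 2 <= 16 by nra.
have h7 : 0 <= eps * (5 - eps) ^+ 2 by apply: mulr_ge0; [lra | exact: sqr_ge0].
rewrite [leRHS](_ : _ = (eps * x - 2 * (5 - eps)) ^+ 2 - 4 * (5 - eps) ^+ 2
   + eps * (5 - eps) ^+ 2 + (4 - eps) * (eps * b) ^+ 2 / eps
   - 14 * (eps * (4 - eps) ^+ 2)); last by field; lra.
have h8 : 432 <= (4 - eps) * (eps * b) ^+ 2 / eps.
  by rewrite ler_pdivlMr //; apply: le_trans h3; lra.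
lra.
Qed.

(** Here [F] and [G] are consecutive Ramsey numbers.  Writing [g] for the bound
    on [F] and [m + 1] for its increment, [F > g] would give
    d >= (F - g) + m, whence d^2 > (F - g) + m^2 >= F - 2; and d <= 2 is
    excluded by m >= 3. *)
Lemma bound_step eps b (F G x d : R) : 0 < eps -> eps <= 1 -> 12 < eps * b ->
  b + 1 <= x ->
  G <= ((x - 1) ^+ 2 - b ^+ 2) / (4 - eps) + 16 ->
  F <= G + (d + 1) -> 0 <= d -> d <= 2 \/ d * d + 2 <= F ->
  F <= (x ^+ 2 - b ^+ 2) / (4 - eps) + 16.
Proof.
move=> e0 e1 eb xb HG HF d0 dF.
have b12 : 12 < b by nra.
have c0 : 4 - eps != 0 by apply/eqP; lra.
have slack := gap_ge_sqrt _ _ _ e0 e1 eb xb.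
set g := (x ^+ 2 - b ^+ 2) / (4 - eps) + 16 in slack *.
set m := (2 * x - 1) / (4 - eps) - 1 in slack *.
have Hm : 3 <= m by rewrite /m lerBrDr ler_pdivlMr; lra.
have gE : ((x - 1) ^+ 2 - b ^+ 2) / (4 - eps) + 16 = g - (m + 1).
  by rewrite /g /m; field.
rewrite leNgt; apply/negP => gF; rewrite gE in HG.
clearbody g m.
have dm : F - g + m <= d by lra.
case: dF => dF; first by lra.
have : (F - g + m) * (F - g + m) <= d * d by apply: ler_pM; lra.
nra.
Qed.

End RealEstimates.

Theorem theorem5p3 (R : realType) (eps : R) (k : nat)
    (heps0 : 0 < eps) (heps1 : eps <= 1) (hk : (6 <= k)%N) :
  let a : R := (5 - 3 / 2 * eps) / (2 - Num.sqrt (4 - eps)) - 6 in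
  [/\ (ramsey 4 3 k 1)%:R
        <= (k%:R - 6) * (k%:R + 6 + 2 * a) / (4 - eps) + 16,
      (k%:R - 6) * (k%:R + 6 + 2 * a) / (4 - eps) + 16
        < (k%:R + a) ^+ 2 / (4 - eps)
    & (ramsey 4 3 k 1)%:R - (ramsey 4 3 (k - 1)%N 1)%:R
        < 1 + (k%:R + a) / Num.sqrt (4 - eps)].
Proof.
set s := Num.sqrt (4 - eps); move=> a.
have s0 : 0 <= s by apply: sqrtr_ge0.
have sE : s ^+ 2 = 4 - eps by rewrite /s sqr_sqrtr //; lra.
have s_gt := sqrt_gt _ _ _ heps1 s0 sE; have s_lt2 := sqrt_lt2 _ _ _ heps0 s0 sE.
pose b := a + 6.
have bE : b * (2 - s) = 5 - 3 / 2 * eps.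
  by rewrite /b /a subrK divfK //; apply/eqP; lra.
have eb := eps_b_gt12 _ _ _ _ heps0 heps1 s0 sE bE.
clearbody s; have b12 : 12 < b by nra.
have aE : a = b - 6 by rewrite /b addrK.
clearbody b; clear bE; clearbody a; subst a.
have boundE (y : R) : (y - 6) * (y + 6 + 2 * (b - 6))
    = (y + (b - 6)) ^+ 2 - b ^+ 2 by ring.
have upper (j : nat) : (6 <= j)%N ->
    (ramsey 4 3 j 1)%:R <= ((j%:R + (b - 6)) ^+ 2 - b ^+ 2) / (4 - eps) + 16.
  elim: j => // j IH; rewrite leq_eqVlt => /orP[/eqP<-|j6].
    have -> : 6%:R + (b - 6) = b by ring.
    by rewrite subrr mul0r add0r (ler_nat R _ 16) ramsey_6_le16.
  have [d [Hd dF]] := ramsey_recurrence j.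
  have j6R : 6 <= j%:R :> R by rewrite (ler_nat R 6).
  apply: (@bound_step R eps b _ (ramsey 4 3 j 1)%:R _ d%:R) => //.
  - by rewrite -natr1; lra.
  - by rewrite -natr1 (_ : _ - 1 = j%:R + (b - 6)); [exact: IH | ring].
  - by rewrite natr1 -natrD ler_nat.
  - case: dF => dF; [left | right]; first by rewrite (ler_nat R _ 2).
    by rewrite -natrM -natrD ler_nat.
have strict : ((k%:R + (b - 6)) ^+ 2 - b ^+ 2) / (4 - eps) + 16
    < (k%:R + (b - 6)) ^+ 2 / (4 - eps).
  rewrite mulrBl -addrA gtrDl addrC subr_lt0 ltr_pdivlMr; last by lra.
  by nra.
rewrite boundE; split=> //; first exact: upper.
have [d [Hd dF]] := ramsey_recurrence (k - 1).
move: Hd dF; rewrite -[(k - 1).+1]addn1 subnK ?(leq_trans _ hk) // => Hd dF.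
have Fd : (ramsey 4 3 k 1)%:R - (ramsey 4 3 (k - 1) 1)%:R <= 1 + d%:R :> R.
  by rewrite lerBlDl nat1r -natrD ler_nat.
apply: le_lt_trans Fd _; rewrite ltrD2l ltr_pdivlMr; last by lra.
have k6 : 6 <= k%:R :> R by rewrite (ler_nat R 6).
have xF := le_lt_trans (upper k hk) strict.
case: dF => dF.
  have : d%:R <= 2 :> R by rewrite (ler_nat R _ 2).
  by nra.
have dR : d%:R * d%:R + 2 <= (ramsey 4 3 k 1)%:R :> R.
  by rewrite -natrM -natrD ler_nat.
move: (le_lt_trans dR xF); rewrite -sE ltr_pdivlMr;
  last by rewrite exprn_gt0 //; lra.
move=> H; rewrite ltNge; apply/negP => le.
have : (k%:R + (b - 6)) ^+ 2 <= (d%:R * s) ^+ 2 by rewrite ler_sqr ?nnegrE //; nra.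
by nra.
Qed.
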